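(* Let $\nu\in\mathcal{P}_2(\mathbb{R}^d)$. For any $\mu,\tilde\mu\in\mathcal{P}_2(\mathbb{R}^d)$, $$W_2\big(\mathscr{P}^{cx}_{\preceq\nu}(\mu),\mathscr{P}^{cx}_{\preceq\nu}(\tilde\mu)\big)\le W_2(\mu,\tilde\mu).$$
   Context: $\mathcal{P}_2(\mathbb{R}^d)$ is the set of Borel probability measures on $\mathbb{R}^d$ with finite second moment, and $W_2$ is the 2-Wasserstein distance, $W_2^2(\rho,\nu)=\inf_{\pi\in\Pi(\rho,\nu)}\int|x-y|^2\,d\pi(x,y)$, with $\Pi(\rho,\nu)$ the set of couplings of $\rho$ and $\nu$. Convex order: $\mu\preceq\nu$ means $\int\varphi\,d\mu\le\int\varphi\,d\nu$ for every convex $\varphi:\mathbb{R}^d\to\mathbb{R}$. Backward projection: $\mathscr{P}^{cx}_{\preceq\nu}(\mu):=\operatorname{argmin}_{\rho\preceq\nu}W_2^2(\rho,\mu)$, which is known to exist uniquely for all $\mu,\nu\in\mathcal{P}_2(\mathbb{R}^d)$. *)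

(* Defs.v *)
From mathcomp Require Import all_boot all_order all_algebra.
From mathcomp Require Import all_classical all_reals all_analysis.

Set Implicit Arguments.
Unset Strict Implicit.
Unset Printing Implicit Defensive.

Import Order.TTheory GRing.Theory Num.Theory.
Import numFieldNormedType.Exports.

Local Open Scope classical_set_scope.
Local Open Scope ring_scope.
Local Open Scope ereal_scope.

(* 'rV[R]_d with its Borel sigma-algebra; the topology of 'rV[R]_d comes from
   the sup norm and hence is the Euclidean one. *)
Definition borel_rV (R : realType) (d : nat) :=
  g_sigma_algebraType (@open 'rV[R]_d).

(* The library norm on 'rV[R]_d is the sup norm, so the squared Euclidean norm
   is spelled out. *)
Definition sqnorm (R : realType) (d : nat) (x : 'rV[R]_d) : R :=
  (\sum_(i < d) x ord0 i ^+ 2)%R.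

Definition sqdist (R : realType) (d : nat) (x y : 'rV[R]_d) : R :=
  sqnorm (x - y)%R.

Definition P2 (R : realType) (d : nat) : set (probability (borel_rV R d) R) :=
  [set mu : probability (borel_rV R d) R | \int[mu]_x (sqnorm x)%:E < +oo].

Definition couplings (R : realType) (d : nat)
    (mu nu : probability (borel_rV R d) R) :
    set (probability (borel_rV R d * borel_rV R d)%type R) :=
  [set pi | forall A : set (borel_rV R d), measurable A ->
     pushforward pi fst A = mu A /\ pushforward pi snd A = nu A].

Definition W2sq (R : realType) (d : nat)
    (mu nu : probability (borel_rV R d) R) : \bar R :=
  ereal_inf [set \int[pi]_z (sqdist z.1 z.2)%:E | pi in couplings mu nu].

Definition W2 (R : realType) (d : nat)
    (mu nu : probability (borel_rV R d) R) : \bar R :=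
  sqrte (W2sq mu nu).

(* A convex function is continuous and has an affine minorant: under mu and nu
   in P2 both integrals are well defined, with values in ]-oo, +oo]. *)
Definition convex_order (R : realType) (d : nat)
    (mu nu : probability (borel_rV R d) R) : Prop :=
  forall phi : 'rV[R]_d -> R, convex_function setT phi ->
    \int[mu]_x (phi x)%:E <= \int[nu]_x (phi x)%:E.

Definition argmin (R : realType) (T : Type) (A : set T) (f : T -> \bar R) :
    set T :=
  [set x | A x /\ forall y, A y -> f x <= f y].

(* The argmin is kept as a set of minimizers; for mu and nu in P2 it is known
   to be a singleton. *)
Definition backward_projection (R : realType) (d : nat)
    (nu mu : probability (borel_rV R d) R) :
    set (probability (borel_rV R d) R) :=
  argmin [set rho | @P2 R d rho /\ convex_order rho nu] (fun rho => W2sq rho mu).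

(* Main.v *)
From HB Require Import structures.
Require Import Defs.
From mathcomp Require Import all_boot all_order all_algebra.
From mathcomp Require Import all_classical all_reals all_analysis.
From mathcomp Require Import measurable_realfun ring lra.
Import numFieldNormedType.Exports.

Set Implicit Arguments.
Unset Strict Implicit.
Unset Printing Implicit Defensive.

Import Order.TTheory GRing.Theory Num.Theory.

Local Open Scope classical_set_scope.
Local Open Scope ring_scope.

(** Among random vectors on a probability space, those whose law precedes [nu] in
    convex order form a convex set: if [Y] and [Y'] are such vectors, integrating
    [phi ((1 - t) Y + t Y') <= (1 - t) phi Y + t phi Y'] shows that
    [(1 - t) Y + t Y'] is one too ([convex_order_interp]). The backward projection
    is thus the law of a metric projection onto a convex set of the Hilbert space
    of square-integrable vectors, and such projections are nonexpansive.

    Concretely, let [X, X', Y, Y'] have laws [mu, mu', rho, rho'], the pairs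
    [(Y, X)] and [(Y', X')] being nearly optimally coupled. Testing the minimality
    of [rho] against the law of [(1 - t) Y + t Y'] bounds the mean of [|Y - Y'|^2]
    by that of [|Y' - X|^2 - |Y - X|^2], up to errors that vanish with [t]
    ([projection_variational]), and the same holds with the roles exchanged. Adding
    the two and using the quadrilateral inequality
    [|Y' - X|^2 + |Y - X'|^2 <= |Y - X|^2 + |Y' - X'|^2 + |Y - Y'|^2 + |X - X'|^2]
    leaves [E |Y - Y'|^2 <= E |X - X'|^2], which is the claim when [(X, X')] runs
    over the couplings of [mu] and [mu'].

    To put the four vectors on one space, the couplings of [(Y, X)], [(X, X')] and
    [(X', Y')] have to be glued along their common marginals. Disintegration is
    avoided by gluing only up to the cells of a fine grid: along a countable
    partition a glued measure is an explicit series ([gluing]), and it gives two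
    copies of [X], and two of [X'], at distance at most the mesh of the grid
    ([approximate_gluing]). The mesh tends to [0] together with [t].

    The convex functions tested by the convex order must be measurable, with
    well-defined integrals. On a finite-dimensional space they are continuous and
    bounded below by a multiple of [-(2 + |x|^2)]; both facts follow from an upper
    bound on cubes ([convex_ubound_cube]). *)

(** * The Borel structure of the space of row vectors *)

Section borel.
Variables (R : realType) (d : nat).
Implicit Types (x y : 'rV[R]_d).

Lemma ball_rVP x (e : R) : 0 < e ->
  ball x e = \bigcap_(i in [set: 'I_d]) [set y : 'rV[R]_d | `|x ord0 i - y ord0 i| < e].
Proof.
move=> e0; apply/seteqP; split => y.
- by move=> [_ xy] i _; exact: xy.
- move=> xy; split => // i j; rewrite (ord1 i); exact: xy.
Qed.

Lemma rat_ball_sub (U : set 'rV[R]_d) x : open U -> U x ->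
  exists (q : 'rV[rat]_d) (k : nat),
    ball (map_mx ratr q : 'rV[R]_d) (k.+1%:R^-1 : R) x /\
    ball (map_mx ratr q : 'rV[R]_d) (k.+1%:R^-1 : R) `<=` U.
Proof.
move=> oU Ux; have /nbhs_ballP[e /= e0 eU] : nbhs x U by exact: open_nbhs_nbhs.
have [k ke] : exists k : nat, (k.+1%:R^-1 : R) < e / 2.
  have := cvgr_lt (0 : R) (@cvg_harmonic R) (e / 2) (divr_gt0 e0 (ltr0Sn _ 1)).
  by move=> [k _ /(_ k (leqnn _)) h]; exists k.
have k0 : 0 < (k.+1%:R^-1 : R) by rewrite invr_gt0 ltr0n.
have /choice[q xq] : forall i, exists q : rat, `|ratr q - x ord0 i| < (k.+1%:R^-1 : R).
  move=> i.
  move: (k.+1%:R^-1 : R) k0 => r r0.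
  have xr : x ord0 i - r < x ord0 i + r by lra.
  have [q] := rat_in_itvoo xr; rewrite in_itv/= => /andP[h1 h2].
  exists q; rewrite ltr_norml.
  by apply/andP; split; lra.
exists (\row_i q i), k; split.
  by rewrite ball_rVP// => i _ /=; rewrite !mxE.
rewrite ball_rVP// => y /= yq; apply: eU; rewrite ball_rVP// => i _ /=.
have := yq i Logic.I; have := xq i; rewrite !mxE => h1 h2.
rewrite (_ : _ - _ = (x ord0 i - ratr (q i)) + (ratr (q i) - y ord0 i)); last by ring.
rewrite (le_lt_trans (ler_normD _ _))// (distrC (x _ _)).
by move: (ltrD h1 h2) ke; move: (k.+1%:R^-1 : R) => r; lra.
Qed.

Lemma open_measurable_rV (U : set (borel_rV R d)) : open (U : set 'rV[R]_d) ->
  measurable U.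
Proof. by move=> oU; apply: sub_sigma_algebra. Qed.

Lemma continuous_measurable_rV (f : 'rV[R]_d -> R) : continuous f ->
  measurable_fun setT (f : borel_rV R d -> R).
Proof.
move=> /continuousP cf; apply: (measurability _ (RGenOpens.measurableE R)).
move=> _ [_ [a [b ->] <-]]; rewrite setTI.
by apply: open_measurable_rV; apply: cf; exact: interval_open.
Qed.

Lemma measurable_coord i : measurable_fun setT (fun x : borel_rV R d => x ord0 i).
Proof. by apply: continuous_measurable_rV; exact: coord_continuous. Qed.

(** The sup-norm balls with rational centre and radius [1 / k.+1] form a countable
    basis made of finite intersections of coordinate conditions. *)
Lemma measurable_fun_rV d' (T : measurableType d') (F : T -> borel_rV R d) :
  (forall i, measurable_fun setT (fun w => F w ord0 i)) ->
  measurable_fun setT F.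
Proof.
move=> mF; apply: (@measurability _ _ T (borel_rV R d) setT F (@open 'rV[R]_d)) => //.
move=> _ [U oU <-]; rewrite setTI.
pose B (p : 'rV[rat]_d * nat) : set 'rV[R]_d :=
  ball (map_mx ratr p.1 : 'rV[R]_d) (p.2.+1%:R^-1 : R).
pose D := [set p | B p `<=` U].
rewrite (_ : _ @^-1` _ = \bigcup_p (if p \in D then F @^-1` B p else set0)); last first.
  apply/seteqP; split => [w /= Uw|w [p _]]; last first.
    by case: ifPn => //; rewrite inE => DU; exact: DU.
  have [q [k [Bx BU]]] := rat_ball_sub oU Uw.
  by exists (q, k) => //; rewrite ifT// inE.
apply: countable_bigcupT_measurable => // p; case: ifP => // _.
rewrite /B ball_rVP; last by rewrite invr_gt0 ltr0n.
rewrite preimage_bigcap; apply: fin_bigcap_measurable => // i _.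
pose q := (map_mx ratr p.1 : 'rV[R]_d) ord0 i.
rewrite [X in measurable X](_ : _ = setT `&` (fun w => `|q - F w ord0 i|) @^-1`
  `]-oo, (p.2.+1%:R^-1 : R)[%classic); last first.
  by rewrite setTI; apply/seteqP; split => w /=; rewrite in_itv.
have m : measurable_fun setT (fun w => `|q - F w ord0 i|).
  apply: measurableT_comp => //; apply: measurable_funB => //; exact: mF.
exact: m.
Qed.

Lemma measurable_sqnorm : measurable_fun setT (@sqnorm R d : borel_rV R d -> R).
Proof.
apply: measurable_sum => i; apply: measurable_funX; exact: measurable_coord.
Qed.

Lemma sqnorm_ge0 x : 0 <= sqnorm x.
Proof. by apply: sumr_ge0 => i _; exact: sqr_ge0. Qed.

(** The cells are the half-open cubes of a grid of mesh [r]; they discretize a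
    law of vectors before gluing. *)
Lemma grid_cells (r : R) : 0 < r -> exists f : 'rV[R]_d -> nat,
  (forall n, measurable (f @^-1` [set n] : set (borel_rV R d))) /\
  (forall x y, f x = f y -> forall i, `|x ord0 i - y ord0 i| <= r).
Proof.
move=> r0; pose fl x : 'rV[int]_d := \row_i Num.floor (x ord0 i / r).
exists (fun x => choice.pickle (fl x)); split => [n|x y /(pcan_inj choice.pickleK) xy i].
- have [[x0 <-]|nx] := pselect (exists x, choice.pickle (fl x) = n); last first.
    rewrite (_ : _ @^-1` _ = set0)//; apply/seteqP; split => // x xn.
    by apply: nx; exists x.
  rewrite (_ : _ @^-1` _ = \bigcap_(i in [set: 'I_d])
      ((fun x : borel_rV R d => x ord0 i / r) @^-1`
       `[(Num.floor (x0 ord0 i / r))%:~R, (Num.floor (x0 ord0 i / r) + 1)%:~R[%classic)).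
    apply: fin_bigcap_measurable => // i _.
    rewrite -[X in measurable X]setTI.
    by apply: measurable_funM => //; exact: measurable_coord.
  apply/seteqP; split => x /=.
    move=> /(pcan_inj choice.pickleK) xx i _ /=.
    have /rowP/(_ i) := xx; rewrite !mxE => <-.
    by rewrite in_itv/= floor_le floorD1_gt.
  move=> xx; congr choice.pickle; apply/rowP => i; rewrite !mxE.
  have := xx i Logic.I; rewrite /= in_itv/=.
  by move=> h; apply: floor_def.
- have /rowP/(_ i) := xy; rewrite !mxE => e.
  have hx1 := floor_le (x ord0 i / r).
  have hx2 := floorD1_gt (x ord0 i / r).
  have hy1 := floor_le (y ord0 i / r).
  have hy2 := floorD1_gt (y ord0 i / r).
  rewrite e intrD1 in hx1 hx2; rewrite intrD1 in hy2.
  have : `|x ord0 i / r - y ord0 i / r| <= 1 by rewrite ler_norml; apply/andP; split; lra.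
  have r1 : 0 <= r^-1 by rewrite invr_ge0 ltW.
  by rewrite -mulrBl normrM (ger0_norm r1) ler_pdivrMr// mul1r.
Qed.

End borel.

(** * Gluing probability measures along a countable partition *)

Section gluing.
Local Open Scope ereal_scope.
Context d1 d2 (T1 : measurableType d1) (T2 : measurableType d2) (R : realType).
Variables (P : probability T1 R) (Q : probability T2 R).
Variables (f : T1 -> nat) (g : T2 -> nat).
Hypothesis mf : forall n, measurable (f @^-1` [set n]).
Hypothesis mg : forall n, measurable (g @^-1` [set n]).
Hypothesis fg : forall n, P (f @^-1` [set n]) = Q (g @^-1` [set n]).

Let cell n := (f @^-1` [set n]) `*` (g @^-1` [set n]).

Let mcell n : measurable (cell n). Proof. exact: measurableX. Qed.

Let p n : {nonneg R} := NngNum (fine_ge0 (measure_ge0 P (f @^-1` [set n]))).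

Let glue_term n : {measure set (T1 * T2) -> \bar R} :=
  mscale ((p n)%:num^-1%:nng)%R (mrestr (P \x Q) (mcell n)).

Let glue : {measure set (T1 * T2) -> \bar R} := mseries glue_term 0.

Let glue_termX n A B : measurable A -> measurable B ->
  glue_term n (A `*` B) = ((p n)%:num^-1)%R%:E *
    (P (A `&` f @^-1` [set n]) * Q (B `&` g @^-1` [set n])).
Proof.
move=> mA mB; rewrite /glue_term /= /mscale /= /mrestr /cell -setXI.
by rewrite product_measure1E//; apply: measurableI.
Qed.

Let pE n : P (f @^-1` [set n]) = (p n)%:num%:E.
Proof. by rewrite /= fineK// fin_num_measure. Qed.

Let measure_cells d (T : measurableType d) (m : {measure set T -> \bar R})
    (h : T -> nat) (mh : forall n, measurable (h @^-1` [set n])) (A : set T) :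
  measurable A -> m A = \sum_(0 <= n <oo) m (A `&` h @^-1` [set n]).
Proof.
move=> mA; have mAn n : measurable (A `&` h @^-1` [set n]) by exact: measurableI.
rewrite -measure_semi_bigcup//.
- rewrite -setI_bigcupr -preimage_bigcup; congr (m _); rewrite -[LHS]setIT.
  by congr setI; apply/seteqP; split => // x _; exists (h x).
- apply/trivIsetP => i j _ _ ij; apply/seteqP; split => // x [[_ /= hi] [_ /= hj]].
  by move: ij; rewrite -hi -hj eqxx.
- exact: bigcup_measurable.
Qed.

Let glue_fst A : measurable A -> glue (A `*` setT) = P A.
Proof.
move=> mA; rewrite /glue /= /mseries (measure_cells P mf mA).
apply: eq_eseriesr => n _; rewrite glue_termX// setTI -fg pE.
have [p0|p0] := eqVneq (p n)%:num 0%R.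
  rewrite p0 mule0 mule0; apply/esym/(@subset_measure0 _ _ _ _ _ (f @^-1` [set n])) => //.
  - exact: measurableI.
  - by have := pE n; rewrite p0.
by rewrite muleCA -EFinM mulVf// mule1.
Qed.

Let glue_snd B : measurable B -> glue (setT `*` B) = Q B.
Proof.
move=> mB; rewrite /glue /= /mseries (measure_cells Q mg mB).
apply: eq_eseriesr => n _; rewrite glue_termX// setTI pE.
have [p0|p0] := eqVneq (p n)%:num 0%R.
  rewrite p0 mul0e mule0; apply/esym/(@subset_measure0 _ _ _ _ _ (g @^-1` [set n])) => //.
  - exact: measurableI.
  - by have := pE n; rewrite p0 fg.
by rewrite muleA -EFinM mulVf// mul1e.
Qed.

Let glue_setT : glue setT = 1.
Proof. by rewrite -setXTT glue_fst// probability_setT. Qed.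

Let gluing_prob : probability (T1 * T2)%type R :=
  HB.pack (mseries glue_term 0)
    (Measure_isProbability.Build _ _ _ (mseries glue_term 0) glue_setT).

(** Conditionally on the cell, the two coordinates are independent: the glued measure
    is the sum over [n] of [P (f = n)^-1] times the restriction of [P \x Q] to
    [f = n] and [g = n]. Summing [P (f = n)^-1 * P (A, f = n) * Q (g = n)] over [n]
    gives back [P A], as [P (f = n) = Q (g = n)]; cells of measure zero contribute
    nothing on either side. *)
Lemma gluing : exists G : probability (T1 * T2)%type R,
  [/\ forall A, measurable A -> G (fst @^-1` A) = P A,
      forall B, measurable B -> G (snd @^-1` B) = Q B &
      {ae G, forall w, f w.1 = g w.2}].
Proof.
exists gluing_prob; split.
- by move=> A mA; have := glue_fst mA; rewrite setXT.
- by move=> B mB; have := glue_snd mB; rewrite setTX.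
pose N := ~` \bigcup_n cell n.
exists N; split.
- by apply: measurableC; apply: bigcup_measurable.
- rewrite /= /mseries eseries0// => n _ _; rewrite /= /mscale /= /mrestr.
  rewrite (_ : N `&` _ = set0) ?measure0 ?mule0//.
  by apply/seteqP; split => // w [wN wc]; apply: wN; exists n.
- by move=> w /= wfg [n _ [/= wf wg]]; apply: wfg; rewrite wf wg.
Qed.

End gluing.

(** * Convex functions on a finite-dimensional space *)

Section convex.
Variables (R : realType) (d : nat) (phi : 'rV[R]_d -> R).
Hypothesis cphi : convex_function setT phi.

Lemma convex_ineq (t : R) x y : 0 <= t <= 1 ->
  phi (t *: x + (1 - t) *: y) <= t * phi x + (1 - t) * phi y.
Proof.
move=> /andP[t0 t1]; have := @cphi (Itv01 t0 t1) x y.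
by rewrite !inE /= => /(_ Logic.I Logic.I).
Qed.

(** Halving splits off one coordinate at a time, at the price of doubling the
    cube: [x + y] is the midpoint of [2 x] and [2 y]. *)
Lemma convex_ubound_cube (r : R) :
  exists M, forall x : 'rV[R]_d, (forall i, `|x ord0 i| <= r) -> phi x <= M.
Proof.
suff H (s : seq 'I_d) (c : R) : exists M,
    forall x : 'rV[R]_d, (forall i, `|x ord0 i| <= c) ->
    phi (\sum_(i <- s) x ord0 i *: delta_mx 0 i) <= M.
  have [M HM] := H (index_enum 'I_d) r; exists M => x xr.
  by rewrite [x]row_sum_delta; exact: HM.
elim: s c => [|i s IH] c; first by exists (phi 0) => x _; rewrite big_nil.
have [M HM] := IH (2 * c).
pose e : 'rV[R]_d := delta_mx 0 i.
pose N := `|phi ((2 * c) *: e)| + `|phi (- ((2 * c) *: e))| + `|phi 0|.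
have HN (a : R) : `|a| <= 2 * c -> phi (a *: e) <= N.
  have [c0|c0] := eqVneq (2 * c) 0.
    rewrite c0 normr_le0 => /eqP ->; rewrite scale0r /N.
    rewrite (le_trans (ler_norm _))// lerDr addr_ge0//.
  move=> ac; have c1 : 0 < 2 * c by rewrite lt_neqAle eq_sym c0 (le_trans _ ac).
  (* the barycentric weight of [a *: e] on the segment [- 2c e, 2c e] *)
  pose t := (1 + a / (2 * c)) / 2.
  have acc : `|a / (2 * c)| <= 1.
    by rewrite normrM normfV (gtr0_norm c1) ler_pdivrMr// mul1r.
  have t01 : 0 <= t <= 1.
    by move: acc; rewrite ler_norml => /andP[? ?]; rewrite /t; apply/andP; split; lra.
  have -> : a *: e = t *: ((2 * c) *: e) + (1 - t) *: (- ((2 * c) *: e)).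
    rewrite scalerN -scaleNr !scalerA -scalerDl; congr (_ *: _); rewrite /t.
    by field; move: c0; rewrite mulf_eq0 negb_or => /andP[].
  rewrite (le_trans (convex_ineq _ _ t01))//.
  move/andP: t01 => [t0 t1].
  have h1 : t * phi ((2 * c) *: e) <= `|phi ((2 * c) *: e)|.
    by rewrite (le_trans (ler_wpM2l t0 (ler_norm _)))// ler_piMl.
  have h2 : (1 - t) * phi (- ((2 * c) *: e)) <= `|phi (- ((2 * c) *: e))|.
    have t1' : 0 <= 1 - t by lra.
    by rewrite (le_trans (ler_wpM2l t1' (ler_norm _)))// ler_piMl//; lra.
  by have := normr_ge0 (phi 0); rewrite /N; lra.
exists ((N + M) / 2) => x xc; rewrite big_cons.
have -> : x ord0 i *: delta_mx 0 i + \sum_(j <- s) x ord0 j *: delta_mx 0 j =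
    2^-1 *: ((2 * x ord0 i) *: e) +
    (1 - 2^-1) *: (\sum_(j <- s) (2 *: x) ord0 j *: delta_mx 0 j).
  have -> : (1 - 2^-1 : R) = 2^-1 by field.
  rewrite scalerA mulrA mulVf ?mul1r ?pnatr_eq0//; congr (_ + _).
  rewrite scaler_sumr; apply: eq_bigr => j _.
  by rewrite mxE scalerA mulrA mulVf ?pnatr_eq0// mul1r.
have x2 j : `|2 * x ord0 j| <= 2 * c by rewrite normrM ger0_norm// ler_pM2l.
apply: le_trans (convex_ineq _ _ _) _; first by apply/andP; split; lra.
have h1 := HN _ (x2 i).
have h2 : phi (\sum_(j <- s) (2 *: x) ord0 j *: delta_mx 0 j) <= M.
  by apply: HM => j; rewrite mxE.
rewrite -/e; lra.
Qed.

(** Convexity scales the upper bound of [phi - phi x0] near [x0] down linearly, and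
    reflecting at [x0] turns upper bounds into lower bounds. *)
Lemma convex_continuous : continuous phi.
Proof.
move=> x0; apply/(@cvgrPdist_le _ _ _ (nbhs x0)) => e e0.
have [M HM] : exists M, 0 < M /\
    forall h : 'rV[R]_d, (forall i, `|h ord0 i| <= 1) -> phi (x0 + h) - phi x0 <= M.
  pose r := 1 + \sum_i `|x0 ord0 i|.
  have [M HM] := convex_ubound_cube r.
  exists (1 + `|M - phi x0|); split; first by rewrite ltr_pwDl.
  move=> h h1; have := HM (x0 + h); have := ler_norm (M - phi x0).
  suff xh : forall i, `|(x0 + h) ord0 i| <= r by move=> ? /(_ xh); lra.
  move=> i; rewrite mxE (le_trans (ler_normD _ _))// addrC lerD//.
  by rewrite (bigD1 i)//= lerDl sumr_ge0.
move: HM => [M0 HM].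
(* [x0 + h] lies between [x0] and [x0 + h / eps] *)
have up (eps : R) (h : 'rV[R]_d) :
    0 < eps -> eps <= 1 -> (forall i, `|h ord0 i| <= eps) ->
    phi (x0 + h) - phi x0 <= eps * M.
  move=> ep0 ep1 hh.
  have -> : x0 + h = eps *: (x0 + eps^-1 *: h) + (1 - eps) *: x0.
    rewrite scalerDr scalerA divff ?gt_eqF// scale1r [RHS]addrAC -scalerDl.
    by rewrite [eps + _]addrC subrK scale1r.
  have := convex_ineq (x0 + eps^-1 *: h) x0 (_ : 0 <= eps <= 1).
  rewrite ep1 ltW// => /(_ isT).
  have /HM : forall i, `|(eps^-1 *: h) ord0 i| <= 1.
    move=> i; rewrite mxE normrM gtr0_norm ?invr_gt0// ler_pdivrMl// mulr1.
    exact: hh.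
  by rewrite -(ler_pM2l ep0); lra.
pose eps := Num.min 1 (e / M).
have ep0 : 0 < eps by rewrite lt_min ltr01 divr_gt0.
have ep1 : eps <= 1 by rewrite ge_min lexx.
have epM : eps * M <= e by rewrite -ler_pdivlMr// ge_min lexx orbT.
apply/nbhs_ballP; exists eps => //= y; rewrite ball_rVP// => xy.
have hy i : `|(y - x0) ord0 i| <= eps.
  by rewrite !mxE distrC; apply/ltW; exact: xy.
have hy' i : `|(- (y - x0)) ord0 i| <= eps.
  by rewrite mxE normrN; exact: hy.
have u1 := up _ _ ep0 ep1 hy; have u2 := up _ _ ep0 ep1 hy'.
(* [x0] is the midpoint of [y] and of its reflection *)
have u3 : phi x0 <= 2^-1 * phi (x0 + (y - x0)) + (1 - 2^-1) * phi (x0 - (y - x0)).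
  have half : 0 <= (2^-1 : R) <= 1 by apply/andP; split; lra.
  have := convex_ineq (x0 + (y - x0)) (x0 - (y - x0)) half.
  have -> : (1 - 2^-1 : R) = 2^-1 by field.
  have -> // : 2^-1 *: (x0 + (y - x0)) + 2^-1 *: (x0 - (y - x0)) = x0.
  by apply/rowP => i; rewrite !mxE; field.
have xy0 : x0 + (y - x0) = y by rewrite addrC subrK.
rewrite xy0 in u1 u3.
by rewrite ler_norml; apply/andP; split; lra.
Qed.

Lemma convex_measurable : measurable_fun setT (phi : borel_rV R d -> R).
Proof. apply: continuous_measurable_rV; exact: convex_continuous. Qed.

(** With [s = 1 + sqnorm x], the point [- x / s] belongs to the unit cube, where
    [phi] is bounded above, and [0] lies between it and [x]; convexity then bounds
    [phi x] from below by [phi 0]. *)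
Lemma convex_lbound : exists2 C, 0 <= C & forall x, - (C * (2 + sqnorm x)) <= phi x.
Proof.
have [M HM] := convex_ubound_cube 1.
exists (`|M| + `|phi 0|) => [|x]; first by rewrite addr_ge0.
have sx := sqnorm_ge0 x.
pose s := 1 + sqnorm x; have s1 : 1 <= s by rewrite lerDl.
have s0 : 0 < s by rewrite (lt_le_trans ltr01).
have xs i : `|x ord0 i| <= s.
  have : x ord0 i ^+ 2 <= sqnorm x.
    by rewrite /sqnorm (bigD1 i)//= lerDl sumr_ge0// => j _; exact: sqr_ge0.
  rewrite -real_normK ?num_real// /s.
  by have := sqr_ge0 (`|x ord0 i| - 1); have := normr_ge0 (x ord0 i); nra.
have /HM hM : forall i, `|(- (s^-1 *: x)) ord0 i| <= 1.
  by move=> i; rewrite !mxE normrN normrM gtr0_norm ?invr_gt0// ler_pdivrMl// mulr1.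
pose t := (1 + s)^-1.
have t0 : 0 < t by rewrite invr_gt0; lra.
have t1 : t * (1 + s) = 1 by rewrite mulVf// gt_eqF//; lra.
have t01 : 0 <= t <= 1 by apply/andP; split; nra.
have := convex_ineq x (- (s^-1 *: x)) t01.
have -> : t *: x + (1 - t) *: (- (s^-1 *: x)) = 0.
  rewrite scalerN scalerA -scaleNr -scalerDl.
  have -> : 1 - t = t * s by rewrite -t1; ring.
  by rewrite mulrK ?unitfE ?gt_eqF// subrr scale0r.
move=> h.
have : (1 + s) * phi 0 <= phi x + s * phi (- (s^-1 *: x)).
  have s1' : 0 <= 1 + s by lra.
  have := ler_wpM2l s1' h; set a := phi x; set b := phi (- _).
  have -> : (1 + s) * (t * a + (1 - t) * b) =
      t * (1 + s) * a + (1 + s - t * (1 + s)) * b by ring.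
  by rewrite t1; lra.
have := ler_wpM2l (ltW s0) hM; have := ler_norm M.
have := ler_norm (- phi 0); rewrite normrN.
have := normr_ge0 M; have := normr_ge0 (phi 0).
by rewrite /s; nra.
Qed.

End convex.

(** * Random vectors and their laws *)

Section law.
Local Open Scope ereal_scope.
Context dT (T : measurableType dT) (R : realType) (P : probability T R).

Definition has_law dU (U : measurableType dU) (X : T -> U)
    (mu : probability U R) : Prop :=
  measurable_fun setT X /\ forall A, measurable A -> P (X @^-1` A) = mu A.

Lemma ex_law dU (U : measurableType dU) (X : T -> U) :
  measurable_fun setT X -> exists mu : probability U R, has_law X mu.
Proof.
move=> mX; exists (distribution P (mfun_Sub (mem_set mX))); split => // A mA.
Qed.

Lemma ge0_integral_law dU (U : measurableType dU) (X : T -> U)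
    (mu : probability U R) (f : U -> \bar R) :
  has_law X mu -> measurable_fun setT f -> (forall x, 0 <= f x) ->
  \int[mu]_x f x = \int[P]_w f (X w).
Proof.
move=> [mX PX] mf f0.
rewrite (eq_measure_integral (pushforward P X)) => [|A mA _]; last exact/esym/PX.
by rewrite ge0_integral_pushforward// => y _; exact: f0.
Qed.

(** The positive and negative parts are transferred separately, so infinite
    integrals are covered. *)
Lemma integral_law dU (U : measurableType dU) (X : T -> U)
    (mu : probability U R) (f : U -> \bar R) :
  has_law X mu -> measurable_fun setT f ->
  \int[mu]_x f x = \int[P]_w f (X w).
Proof.
move=> PX mf; rewrite integralE [RHS]integralE.
rewrite (funepos_comp f X) (funeneg_comp f X); congr (_ - _).
- by rewrite (ge0_integral_law PX (measurable_funepos mf)).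
- by rewrite (ge0_integral_law PX (measurable_funeneg mf)).
Qed.

(** A lower bound by an integrable function makes [f] integrable as soon as its
    integral, possibly infinite a priori, is not [+oo]. *)
Lemma integrable_lbound (f k : T -> R) : measurable_fun setT f ->
  P.-integrable setT (EFin \o k) -> (forall w, - k w <= f w)%R ->
  (forall w, 0 <= k w)%R ->
  \int[P]_w (f w)%:E < +oo -> P.-integrable setT (EFin \o f).
Proof.
move=> mf ik kf k0 foo; apply/integrableP; split; first exact/measurable_EFinP.
rewrite integral_fin_num_abs// fin_numElt foo andbT.
have fn : \int[P]_w ((EFin \o f)^\- w) < +oo.
  have /integrableP[mk] := ik; apply: le_lt_trans; apply: ge0_le_integral => //.
  - exact/measurable_funeneg/measurable_EFinP.
  - exact: measurableT_comp.
  - move=> w _; rewrite funenegE /= -EFin_max lee_fin ge_max normr_ge0 andbT.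
    by rewrite (le_trans _ (ler_norm _))// lerNl.
have fp : 0 <= \int[P]_w ((EFin \o f)^\+ w) by exact: integral_ge0.
rewrite -/(EFin \o f) integralE.
have fn0 : 0 <= \int[P]_w ((EFin \o f)^\- w) by exact: integral_ge0.
have fnf : \int[P]_w ((EFin \o f)^\- w) \is a fin_num by rewrite ge0_fin_numE.
by rewrite (lt_le_trans _ (leeB fp (lexx _)))// sub0e -[ltLHS]/(- +oo) lteN2.
Qed.

End law.

Lemma has_law_comp dT (T : measurableType dT) dU (U : measurableType dU)
    dV (V : measurableType dV) (R : realType) (P : probability T R)
    (Q : probability U R) (mu : probability V R) (F : T -> U) (X : U -> V) :
  has_law P F Q -> has_law Q X mu -> has_law P (X \o F) mu.
Proof.
move=> [mF PF] [mX QX]; split; first exact: measurableT_comp.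
move=> A mA; rewrite comp_preimage PF ?QX//.
by rewrite -[X in measurable X]setTI; exact: mX.
Qed.

Lemma ae_has_law dT (T : measurableType dT) dU (U : measurableType dU)
    (R : realType) (P : probability T R) (Q : probability U R) (F : T -> U) (A : set U) :
  has_law P F Q -> {ae Q, forall u, A u} -> {ae P, forall w, A (F w)}.
Proof.
move=> [mF PF] [N [mN N0 AN]]; exists (F @^-1` N); split.
- by rewrite -[X in measurable X]setTI; exact: mF.
- by rewrite -N0; exact: PF.
- by move=> w /= nA; exact: AN.
Qed.

(** * Square-integrable random vectors, transport cost and convex order *)

Lemma measurable_comb dT (T : measurableType dT) (R : realType) (d : nat) (a b : R)
    (X Y : T -> borel_rV R d) : measurable_fun setT X ->
  measurable_fun setT Y ->
  measurable_fun setT (fun w => a *: X w + b *: Y w : borel_rV R d).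
Proof.
move=> mX mY; apply: measurable_fun_rV => i.
under eq_fun do rewrite !mxE.
by apply: measurable_funD; apply: measurable_funM => //;
  apply: (measurableT_comp (measurable_coord i)).
Qed.

Lemma measurable_sqdist dT (T : measurableType dT) (R : realType) (d : nat)
    (X Y : T -> borel_rV R d) :
  measurable_fun setT X -> measurable_fun setT Y ->
  measurable_fun setT (fun w => sqdist (X w) (Y w)).
Proof.
move=> mX mY; apply: (measurableT_comp (@measurable_sqnorm R d)).
have := measurable_comb 1 (-1) mX mY.
by under eq_fun do rewrite scale1r scaleN1r.
Qed.

(** The difference of the two sides is the squared norm of [(y - y') - (x - x')]. *)
Lemma sqdist_quadrilateral (R : realType) (d : nat) (x x' y y' : 'rV[R]_d) :
  sqdist y' x + sqdist y x' <=
  (sqdist y x + sqdist y' x') + (sqdist y y' + sqdist x x').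
Proof.
rewrite /sqdist /sqnorm -!big_split /=; apply: ler_sum => i _; rewrite !mxE.
have := sqr_ge0 ((y ord0 i - y' ord0 i) - (x ord0 i - x' ord0 i)).
by rewrite !expr2; lra.
Qed.

Section vectors.
Context dT (T : measurableType dT) (R : realType) (P : probability T R) (d : nat).
Implicit Types (X Y Z : T -> borel_rV R d) (mu rho sigma : probability (borel_rV R d) R).

(** Square integrability is bundled with measurability, the pair that every
    statement about mean squared distances asks for. *)
Definition sqint X : Prop :=
  measurable_fun setT X /\ P.-integrable setT (EFin \o (fun w => sqnorm (X w))).

Definition msqdist X Y : R := \int[P]_w sqdist (X w) (Y w).

Lemma sqint_law X mu : has_law P X mu -> P2 mu -> sqint X.
Proof.
move=> [mX PX] mu2; split=> //; apply/integrableP.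
have msn : measurable_fun setT (fun w => sqnorm (X w)).
  by apply: measurableT_comp => //; exact: measurable_sqnorm.
split; first exact/measurable_EFinP.
rewrite integral_fin_num_abs// ge0_fin_numE; last first.
  by apply: integral_ge0 => w _; rewrite lee_fin sqnorm_ge0.
rewrite -(@ge0_integral_law _ _ _ P _ _ X mu (fun x => (sqnorm x)%:E)) => //.
- apply/measurable_EFinP; exact: measurable_sqnorm.
- by move=> x; rewrite lee_fin sqnorm_ge0.
Qed.

Lemma law_P2 X mu : has_law P X mu -> sqint X -> P2 mu.
Proof.
move=> PX [mX iX]; rewrite /P2 /= (ge0_integral_law PX); first last.
- by move=> x; rewrite lee_fin sqnorm_ge0.
- by apply/measurable_EFinP; exact: measurable_sqnorm.
exact: integrable_lty iX.
Qed.

Lemma sqnorm_comb (a b : R) (x y : 'rV[R]_d) :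
  sqnorm (a *: x + b *: y) <= 2 * a ^+ 2 * sqnorm x + 2 * b ^+ 2 * sqnorm y.
Proof.
rewrite /sqnorm !mulr_sumr -big_split /=; apply: ler_sum => i _; rewrite !mxE.
by have := sqr_ge0 (a * x ord0 i - b * y ord0 i); nra.
Qed.

Lemma integrable_affine (a b : R) (f g : T -> R) :
  P.-integrable setT (EFin \o f) -> P.-integrable setT (EFin \o g) ->
  P.-integrable setT (EFin \o (fun w => a * f w + b * g w)).
Proof.
move=> fi gi.
have := integrableD measurableT (integrableZl measurableT a fi)
  (integrableZl measurableT b gi).
by apply: eq_integrable.
Qed.

Lemma Rintegral_affine (a b : R) (f g : T -> R) :
  P.-integrable setT (EFin \o f) -> P.-integrable setT (EFin \o g) ->
  \int[P]_w (a * f w + b * g w) = a * \int[P]_w f w + b * \int[P]_w g w.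
Proof.
move=> fi gi; rewrite RintegralD ?RintegralZl//.
- exact: (integrableZl measurableT a fi).
- exact: (integrableZl measurableT b gi).
Qed.

Lemma sqint_comb (a b : R) X Y : sqint X -> sqint Y ->
  sqint (fun w => a *: X w + b *: Y w).
Proof.
move=> [mX iX] [mY iY].
have mZ := measurable_comb a b mX mY; split=> //.
apply: le_integrable (integrable_affine (2 * a ^+ 2) (2 * b ^+ 2) iX iY) => //.
- apply/measurable_EFinP; exact: (measurableT_comp (@measurable_sqnorm R d) mZ).
- move=> w _ /=; rewrite lee_fin !ger0_norm ?sqnorm_comb ?sqnorm_ge0//.
  by rewrite addr_ge0// mulr_ge0 ?sqnorm_ge0// mulr_ge0 ?sqr_ge0.
Qed.

Lemma sqint_sqdist X Y : sqint X -> sqint Y ->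
  P.-integrable setT (EFin \o (fun w => sqdist (X w) (Y w))).
Proof.
move=> iX iY; have [_] := sqint_comb 1 (-1) iX iY; apply: eq_integrable => // w _.
by rewrite /= /sqdist scale1r scaleN1r.
Qed.

Lemma msqdistE X Y : sqint X -> sqint Y ->
  (\int[P]_w (sqdist (X w) (Y w))%:E = (msqdist X Y)%:E)%E.
Proof.
move=> iX iY; rewrite /msqdist /Rintegral fineK//.
exact: (integrable_fin_num measurableT (sqint_sqdist iX iY)).
Qed.

Lemma law_pair X Y mu rho : has_law P X mu -> has_law P Y rho ->
  exists2 pi, couplings mu rho pi & has_law P (fun w => (X w, Y w)) pi.
Proof.
move=> [mX PX] [mY PY].
have mXY : measurable_fun setT (fun w => (X w, Y w)) by exact: measurable_fun_pair.
have [pi Ppi] := ex_law P mXY; exists pi => // A mA; rewrite /pushforward.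
have [_ {}Ppi] := Ppi; rewrite -PX// -PY// -!Ppi// -[X in measurable X]setTI.
- exact: measurable_snd.
- exact: measurable_fst.
Qed.

Lemma W2sq_le X Y mu rho : has_law P X mu -> has_law P Y rho -> sqint X -> sqint Y ->
  (W2sq mu rho <= (msqdist X Y)%:E)%E.
Proof.
move=> PX PY iX iY; have [pi cpi Ppi] := law_pair PX PY.
apply: ereal_inf_lbound; exists pi => //; rewrite -msqdistE//.
rewrite (ge0_integral_law Ppi)//= => [|z]; last by rewrite lee_fin sqnorm_ge0.
by apply/measurable_EFinP; exact: measurable_sqdist.
Qed.

Lemma msqdist_sym X Y : msqdist X Y = msqdist Y X.
Proof.
apply: eq_Rintegral => w _; rewrite /sqdist /sqnorm; apply: eq_bigr => i _.
by rewrite !mxE -sqrrN opprB.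
Qed.

Lemma msqdist_quadrilateral X X' Y Y' :
  sqint X -> sqint X' -> sqint Y -> sqint Y' ->
  msqdist Y' X + msqdist Y X' <=
  (msqdist Y X + msqdist Y' X') + (msqdist Y Y' + msqdist X X').
Proof.
move=> iX iX' iY iY'.
have iA := sqint_sqdist iY iX; have iB := sqint_sqdist iY' iX'.
have iD := sqint_sqdist iY iY'; have iS := sqint_sqdist iX iX'.
have iL := sqint_sqdist iY' iX; have iL' := sqint_sqdist iY iX'.
have iAB := integrable_affine 1 1 iA iB; have iDS := integrable_affine 1 1 iD iS.
have := le_Rintegral measurableT (integrable_affine 1 1 iL iL')
  (integrable_affine 1 1 iAB iDS).
rewrite (Rintegral_affine _ _ iL iL') (Rintegral_affine _ _ iAB iDS).
rewrite (Rintegral_affine _ _ iA iB) (Rintegral_affine _ _ iD iS) !mul1r.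
by apply => w _; rewrite !mul1r; exact: sqdist_quadrilateral.
Qed.

Lemma msqdist_ae_le (a b : R) X X' Z Z' : 0 <= a -> 0 <= b ->
  sqint X -> sqint X' -> sqint Z -> sqint Z' ->
  {ae P, forall w, sqdist (X w) (X' w) <= a * sqdist (Z w) (Z' w) + b} ->
  msqdist X X' <= a * msqdist Z Z' + b.
Proof.
move=> a0 b0 iX iX' iZ iZ' ae.
have i1 : P.-integrable setT (EFin \o (fun=> 1 : R)).
  exact: finite_measure_integrable_cst.
have iS := sqint_sqdist iZ iZ'; have iR := integrable_affine a b iS i1.
have <- : \int[P]_w (a * sqdist (Z w) (Z' w) + b * 1) = a * msqdist Z Z' + b.
  rewrite (Rintegral_affine _ _ iS i1) Rintegral_cst// [X in fine X](_ : _ = 1%E).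
    by rewrite !mulr1.
  exact: probability_setT.
rewrite -lee_fin -msqdistE// /Rintegral fineK; last first.
  exact: (integrable_fin_num measurableT iR).
apply: ae_ge0_le_integral => //.
- by move=> w _; rewrite lee_fin sqnorm_ge0.
- by apply/measurable_EFinP; apply: measurable_sqdist; [exact: iX.1|exact: iX'.1].
- by move=> w _; rewrite lee_fin mulr1 addr_ge0// mulr_ge0// sqnorm_ge0.
- exact: measurable_int iR.
- by apply: filterS ae => w h _; rewrite lee_fin mulr1.
Qed.

End vectors.

Lemma msqdist_law dT (T : measurableType dT) dU (U : measurableType dU)
    (R : realType) (d : nat) (P : probability T R) (Q : probability U R)
    (F : T -> U) (X Y : U -> borel_rV R d) :
  has_law P F Q -> measurable_fun setT X -> measurable_fun setT Y ->
  msqdist P (X \o F) (Y \o F) = msqdist Q X Y.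
Proof.
move=> PF mX mY; rewrite /msqdist /Rintegral; congr fine; apply/esym.
apply: (integral_law (f := fun u => (sqdist (X u) (Y u))%:E) PF).
by apply/measurable_EFinP; exact: measurable_sqdist.
Qed.

Section couplings.
Variables (R : realType) (d : nat).
Implicit Types (mu rho nu sigma : probability (borel_rV R d) R).

Lemma coupling_fst mu rho pi : couplings mu rho pi ->
  has_law pi (fst : borel_rV R d * borel_rV R d -> _) mu.
Proof. by move=> cpi; split => // A /cpi[]. Qed.

Lemma coupling_snd mu rho pi : couplings mu rho pi ->
  has_law pi (snd : borel_rV R d * borel_rV R d -> _) rho.
Proof. by move=> cpi; split => // A /cpi[]. Qed.

Lemma W2sq_ge0 mu rho : (0 <= W2sq mu rho)%E.
Proof.
apply/ereal_infP => _ [pi _ <-]; apply: integral_ge0 => z _.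
by rewrite lee_fin sqnorm_ge0.
Qed.

Lemma W2sq_fin_num mu rho : P2 mu -> P2 rho -> W2sq mu rho \is a fin_num.
Proof.
move=> mu2 rho2.
have cpi : couplings mu rho (mu \x rho)%E.
  move=> A mA; rewrite /pushforward; split.
    have := product_measure1E mu rho mA measurableT.
    rewrite setXT => h; apply: (etrans h); rewrite [X in (_ * X)%E](_ : _ = 1%E) ?mule1//.
    exact: probability_setT.
  have := product_measure1E mu rho measurableT mA.
  rewrite setTX => h; apply: (etrans h); rewrite [X in (X * _)%E](_ : _ = 1%E) ?mul1e//.
  exact: probability_setT.
have P1 := coupling_fst cpi; have P2 := coupling_snd cpi.
rewrite ge0_fin_numE ?W2sq_ge0//; apply: le_lt_trans (W2sq_le P1 P2 _ _) _;
  last exact: ltry.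
- exact: sqint_law P1 mu2.
- exact: sqint_law P2 rho2.
Qed.

Lemma ex_near_optimal_coupling mu rho (e : R) : P2 mu -> P2 rho -> 0 < e ->
  exists2 pi, couplings mu rho pi &
    msqdist pi (fst : _ -> borel_rV R d) (snd : _ -> borel_rV R d) <=
      fine (W2sq mu rho) + e.
Proof.
move=> mu2 rho2 e0; have Wfin := W2sq_fin_num mu2 rho2.
have [_ [pi cpi <-]] := lb_ereal_inf_adherent e0 Wfin.
have P1 := coupling_fst cpi; have P2 := coupling_snd cpi.
rewrite (msqdistE (sqint_law P1 mu2) (sqint_law P2 rho2)) -/(W2sq mu rho).
by rewrite -{1}(fineK Wfin) -EFinD lte_fin => h; exists pi => //; exact: ltW.
Qed.

End couplings.

Section projection.
Context dT (T : measurableType dT) (R : realType) (P : probability T R) (d : nat).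
Implicit Types (X Y : T -> borel_rV R d) (mu rho nu sigma : probability (borel_rV R d) R).

(** The random vectors whose law precedes [nu] form a convex set: integrate the
    pointwise convexity inequality. The bound of [convex_lbound] makes the three
    integrals finite whenever the one against [nu] is. *)
Lemma convex_order_interp Y Y' rho rho' sigma nu (t : R) :
  0 <= t <= 1 -> sqint P Y -> sqint P Y' -> has_law P Y rho -> has_law P Y' rho' ->
  has_law P (fun w => (1 - t) *: Y w + t *: Y' w : borel_rV R d) sigma ->
  convex_order rho nu -> convex_order rho' nu -> convex_order sigma nu.
Proof.
move=> t01 iY iY' PY PY' PZ cY cY' phi cphi.
have mphi := convex_measurable cphi.
have mphi' : measurable_fun setT (EFin \o phi : borel_rV R d -> _).
  exact/measurable_EFinP.
have [->|nufin] := eqVneq (\int[nu]_x (phi x)%:E)%E +oo%E; first exact: leey.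
have nuoo : (\int[nu]_x (phi x)%:E < +oo)%E by rewrite ltey.
have [C C0 phiC] := convex_lbound cphi.
(* [- k X] is an integrable minorant of [phi \o X] *)
pose k X w := C * 2 + C * sqnorm (X w).
have kX X : sqint P X -> P.-integrable setT (EFin \o k X).
  move=> [mX iX].
  have i1 : P.-integrable setT (EFin \o (fun=> 2 : R)).
    by apply: finite_measure_integrable_cst.
  have := integrable_affine C C i1 iX; by apply: eq_integrable.
have kphi X w : - k X w <= phi (X w) by rewrite /k -mulrDr; exact: phiC.
have k0 X w : 0 <= k X w.
  by rewrite /k addr_ge0 ?mulr_ge0 ?sqnorm_ge0.
have intphi X tau : has_law P X tau -> sqint P X -> convex_order tau nu ->
    P.-integrable setT (EFin \o (fun w => phi (X w))) /\
    ((\int[P]_w phi (X w))%:E <= \int[nu]_x (phi x)%:E)%E.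
  move=> PX iX cX.
  have le : (\int[P]_w (phi (X w))%:E <= \int[nu]_x (phi x)%:E)%E.
    by rewrite -(integral_law PX mphi'); exact: cX.
  have iphi : P.-integrable setT (EFin \o (fun w => phi (X w))).
    apply: (@integrable_lbound _ _ _ P _ (k X)) => //.
    - by apply: measurableT_comp => //; exact: iX.1.
    - exact: kX.
    - exact: le_lt_trans le nuoo.
  by split => //; rewrite /Rintegral fineK//;
    exact: (integrable_fin_num measurableT iphi).
have [i1 l1] := intphi _ _ PY iY cY.
have [i2 l2] := intphi _ _ PY' iY' cY'.
pose Z w : borel_rV R d := (1 - t) *: Y w + t *: Y' w.
have iZ : sqint P Z by exact: sqint_comb.
have i12 := integrable_affine (1 - t) t i1 i2.
have Zle w : phi (Z w) <= (1 - t) * phi (Y w) + t * phi (Y' w).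
  have t01' : 0 <= 1 - t <= 1 by move/andP: t01 => [? ?]; apply/andP; split; lra.
  by have := convex_ineq cphi (Y w) (Y' w) t01'; rewrite subKr.
have mZ : measurable_fun setT (fun w => phi (Z w)).
  by apply: measurableT_comp => //; exact: PZ.1.
have i3 : P.-integrable setT (EFin \o (fun w => phi (Z w))).
  apply: le_integrable (integrableD measurableT (kX _ iZ) (integrable_abse i12)) => //.
    exact/measurable_EFinP.
  move=> w _ /=; have g0 : 0 <= k Z w + `|(1 - t) * phi (Y w) + t * phi (Y' w)|.
    by apply: addr_ge0; [exact: k0|exact: normr_ge0].
  rewrite lee_fin [leRHS]ger0_norm// ler_norml.
  have := kphi Z w; have := Zle w; have := k0 Z w.
  set g := (1 - t) * _ + _; have := ler_norm g; have := normr_ge0 g.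
  by move=> *; apply/andP; split; lra.
have -> : (\int[sigma]_x (phi x)%:E = \int[P]_w (phi (Z w))%:E)%E.
  exact: integral_law PZ mphi'.
rewrite -[leLHS](fineK (integrable_fin_num measurableT i3)).
rewrite -/(Rintegral P setT (fun w => phi (Z w))).
have : \int[P]_w phi (Z w) <= (1 - t) * \int[P]_w phi (Y w) + t * \int[P]_w phi (Y' w).
  rewrite -Rintegral_affine//; apply: le_Rintegral => // w _; exact: Zle.
case: (\int[nu]_x (phi x)%:E)%E l1 l2 nuoo => [c| |]//.
rewrite !lee_fin; move/andP: t01 => [t0 t1] *.
have t1' : 0 <= 1 - t by lra.
by nra.
Qed.

(** Minimality of [rho] is only tested against the interpolations between [Y] and
    [Y']; what it yields is the variational inequality of the projection onto a
    convex set, in a form free of inner products. *)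
Lemma projection_variational nu mu rho rho' X Y Y' (t : R) :
  0 <= t <= 1 -> has_law P X mu -> has_law P Y rho -> has_law P Y' rho' ->
  P2 mu -> backward_projection nu mu rho -> P2 rho' -> convex_order rho' nu ->
  fine (W2sq rho mu) + t * (1 - t) * msqdist P Y Y' <=
  (1 - t) * msqdist P Y X + t * msqdist P Y' X.
Proof.
move=> t01 PX PY PY' mu2 [[rho2 crho] rhomin] rho'2 crho'.
have iX := sqint_law PX mu2; have iY := sqint_law PY rho2.
have iY' := sqint_law PY' rho'2.
pose Z w : borel_rV R d := (1 - t) *: Y w + t *: Y' w.
have iZ : sqint P Z by exact: sqint_comb.
have [sigma PZ] := ex_law P iZ.1.
have sigma2 := law_P2 PZ iZ.
have csigma := convex_order_interp t01 iY iY' PY PY' PZ crho crho'.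
have h : fine (W2sq rho mu) <= msqdist P Z X.
  rewrite -lee_fin fineK ?W2sq_fin_num//.
  exact: le_trans (rhomin _ (conj sigma2 csigma)) (W2sq_le PZ PX iZ iX).
suff -> : (1 - t) * msqdist P Y X + t * msqdist P Y' X =
    msqdist P Z X + t * (1 - t) * msqdist P Y Y' by rewrite lerD2r.
(* |(1 - t) y + t y' - x|^2 = (1 - t) |y - x|^2 + t |y' - x|^2 - t (1 - t) |y - y'|^2 *)
rewrite /msqdist -Rintegral_affine; try exact: sqint_sqdist.
rewrite -[in RHS](mul1r (Rintegral _ _ _)) -Rintegral_affine; try exact: sqint_sqdist.
apply: eq_Rintegral => w _; rewrite mul1r /sqdist /sqnorm !mulr_sumr -!big_split /=.
by apply: eq_bigr => i _; rewrite !mxE; ring.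
Qed.

End projection.

(** * Nonexpansiveness *)

Section nonexpansive.
Variables (R : realType) (d : nat).
Implicit Types (mu rho nu : probability (borel_rV R d) R).
Local Notation V := (borel_rV R d).
Local Notation VV := (borel_rV R d * borel_rV R d)%type.

(** Exact gluing would identify the second marginal of [p1] with the first one of
    [p], which requires disintegrating the couplings; matching the two points only
    up to a cell of a grid of mesh [r] requires nothing but countable sums. *)
Lemma approximate_gluing mu mu' rho rho' (p1 p p2 : probability VV R) (r : R) :
  0 < r -> couplings rho mu p1 -> couplings mu mu' p -> couplings rho' mu' p2 ->
  exists G : probability ((VV * VV) * VV)%type R,
  [/\ has_law G (fst \o fst) p1, has_law G (snd \o fst) p, has_law G snd p2 &
      {ae G, forall w : ((VV * VV) * VV)%type, forall i : 'I_d,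
         `|w.1.1.2 ord0 i - w.1.2.1 ord0 i| <= r /\
         `|w.2.2 ord0 i - w.1.2.2 ord0 i| <= r}].
Proof.
move=> r0 c1 c c2; have [f [mf fr]] := grid_cells d r0.
have mpre dU (U : measurableType dU) (h : U -> V) n : measurable_fun setT h ->
    measurable ((f \o h) @^-1` [set n]).
  by move=> mh; rewrite comp_preimage -[X in measurable X]setTI; apply: mh.
have [G1 [G1p1 G1p G1ae]] := @gluing _ _ VV VV R p1 p (f \o snd) (f \o fst)
  (fun n => mpre _ _ snd n measurable_snd) (fun n => mpre _ _ fst n measurable_fst)
  (fun n => etrans (c1 _ (mf n)).2 (esym (c _ (mf n)).1)).
have l1 : has_law G1 (fst : VV * VV -> VV) p1 by split.
have l2 : has_law G1 (snd : VV * VV -> VV) p by split.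
have l22 : has_law G1 ((snd : VV -> V) \o (snd : VV * VV -> VV)) mu'.
  exact: has_law_comp l2 (coupling_snd c).
have [G [GG1 Gp2 Gae]] := @gluing _ _ (VV * VV)%type VV R G1 p2
  (f \o (snd \o snd)) (f \o snd)
  (fun n => mpre _ _ _ n l22.1) (fun n => mpre _ _ snd n measurable_snd)
  (fun n => etrans (l22.2 _ (mf n)) (esym (c2 _ (mf n)).2)).
have l3 : has_law G (fst : (VV * VV) * VV -> VV * VV) G1 by split.
exists G; split.
- exact: has_law_comp l3 l1.
- exact: has_law_comp l3 l2.
- by split.
- have := ae_has_law l3 G1ae; apply: filterS2 Gae => w /= e2 e1 i.
  split; first exact: fr.
  by apply: fr; rewrite e2.
Qed.

(** Each coordinate of [x - x'] is within [2 * r] of that of [z - z'], and the cross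
    term [4 * r * `|b|] in the square is absorbed by [2 * r * (1 + b ^+ 2)]. *)
Lemma sqdist_near (r : R) (x x' z z' : 'rV[R]_d) : 0 < r <= 1 ->
  (forall i, `|x ord0 i - z ord0 i| <= r /\ `|x' ord0 i - z' ord0 i| <= r) ->
  sqdist x x' <= (1 + 2 * r) * sqdist z z' + 6 * d%:R * r.
Proof.
move=> /andP[r0 r1] h.
have -> : 6 * d%:R * r = \sum_(i < d) 6 * r.
  by rewrite sumr_const card_ord -mulr_natl; ring.
rewrite /sqdist /sqnorm mulr_sumr -big_split /=; apply: ler_sum => i _.
rewrite !mxE; have [] := h i; rewrite !ler_norml => /andP[? ?] /andP[? ?].
set a := x ord0 i - x' ord0 i; set b := z ord0 i - z' ord0 i.
have ab : `|a - b| <= 2 * r by rewrite ler_norml /a /b; apply/andP; split; lra.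
have ab2 : (a - b) ^+ 2 <= 4 * r ^+ 2.
  by rewrite -real_normK ?num_real//; have := normr_ge0 (a - b); nra.
have ab1 : (a - b) * b <= r * (1 + b ^+ 2).
  rewrite (le_trans (ler_norm _))// normrM.
  have := normr_ge0 b; have := sqr_ge0 (`|b| - 1); rewrite -(real_normK (num_real b)).
  by have := normr_ge0 (a - b); nra.
by rewrite expr2 in ab2 *; nra.
Qed.

(** The near-optimality error, [t ^+ 2], has to be [o(t)] because the variational
    inequalities are divided by [t]; the mesh of the gluing is taken equal to [t]. *)
Lemma W2sq_projection_near nu mu mu' rho rho' (p : probability VV R) (t : R) :
  P2 mu -> P2 mu' -> backward_projection nu mu rho ->
  backward_projection nu mu' rho' -> couplings mu mu' p -> 0 < t -> t <= 2^-1 ->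
  (1 - 2 * t) * fine (W2sq rho rho') <=
  (1 + 2 * t) * msqdist p (fst : VV -> V) (snd : VV -> V) + (6 * d%:R + 2) * t.
Proof.
move=> mu2 mu2' hrho hrho' cp t0 th.
have t01 : 0 <= t <= 1 by apply/andP; split; lra.
have t01' : 0 < t <= 1 by rewrite t0; case/andP: t01.
have a0 : 0 <= 1 + 2 * t by lra.
have b0 : 0 <= 6 * d%:R * t by rewrite !mulr_ge0// ltW.
have [[rho2 crho] _] := hrho; have [[rho2' crho'] _] := hrho'.
have tt : 0 < t ^+ 2 by rewrite exprn_gt0.
have [p1 cp1 A1] := ex_near_optimal_coupling rho2 mu2 tt.
have [p2 cp2 B1] := ex_near_optimal_coupling rho2' mu2' tt.
have [G [l1 l l2 ae]] := approximate_gluing t0 cp1 cp cp2.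
pose Y := (fst : VV -> V) \o (fst \o (fst : (VV * VV) * VV -> VV * VV)).
pose X := (snd : VV -> V) \o (fst \o (fst : (VV * VV) * VV -> VV * VV)).
pose Z := (fst : VV -> V) \o (snd \o (fst : (VV * VV) * VV -> VV * VV)).
pose Z' := (snd : VV -> V) \o (snd \o (fst : (VV * VV) * VV -> VV * VV)).
pose Y' := (fst : VV -> V) \o (snd : (VV * VV) * VV -> VV).
pose X' := (snd : VV -> V) \o (snd : (VV * VV) * VV -> VV).
have lY : has_law G Y rho := has_law_comp l1 (coupling_fst cp1).
have lX : has_law G X mu := has_law_comp l1 (coupling_snd cp1).
have lZ : has_law G Z mu := has_law_comp l (coupling_fst cp).
have lZ' : has_law G Z' mu' := has_law_comp l (coupling_snd cp).
have lY' : has_law G Y' rho' := has_law_comp l2 (coupling_fst cp2).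
have lX' : has_law G X' mu' := has_law_comp l2 (coupling_snd cp2).
have iY := sqint_law lY rho2; have iX := sqint_law lX mu2.
have iZ := sqint_law lZ mu2; have iZ' := sqint_law lZ' mu2'.
have iY' := sqint_law lY' rho2'; have iX' := sqint_law lX' mu2'.
have eA : msqdist G Y X = msqdist p1 fst snd.
  exact: msqdist_law l1 measurable_fst measurable_snd.
have eB : msqdist G Y' X' = msqdist p2 fst snd.
  exact: msqdist_law l2 measurable_fst measurable_snd.
have ew : msqdist G Z Z' = msqdist p fst snd.
  exact: msqdist_law l measurable_fst measurable_snd.
have V1 := projection_variational t01 lX lY lY' mu2 hrho rho2' crho'.
have V2 := projection_variational t01 lX' lY' lY mu2' hrho' rho2 crho.
have quad := msqdist_quadrilateral iX iX' iY iY'.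
have SX : msqdist G X X' <= (1 + 2 * t) * msqdist p fst snd + 6 * d%:R * t.
  rewrite -ew; apply: msqdist_ae_le => //.
  by apply: filterS ae => w; exact: sqdist_near.
have W : fine (W2sq rho rho') <= msqdist G Y Y'.
  by rewrite -lee_fin fineK ?W2sq_fin_num//; exact: W2sq_le.
rewrite eA in V1 quad; rewrite eB in V2 quad; rewrite (msqdist_sym G Y' Y) in V2.
move: (msqdist p1 _ _) (msqdist p2 _ _) (msqdist G Y' X) (msqdist G Y X')
  (msqdist G Y Y') (msqdist G X X') (msqdist p _ _) (fine (W2sq rho rho'))
  (fine (W2sq rho mu)) (fine (W2sq rho' mu')) A1 B1 V1 V2 quad SX W
  => A B P Q D S w W a b A1 B1 V1 V2 quad SX WD.
clear -t0 th A1 B1 V1 V2 quad SX WD.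
(* [V1 + V2], with [quad] bounding the mixed terms and [A1], [B1] the costs *)
have h : t * (2 * (1 - t) * D) <= t * (2 * t + D + S) by nra.
have {}h : 2 * (1 - t) * D <= 2 * t + D + S by rewrite -(ler_pM2l t0).
have : (1 - 2 * t) * W <= (1 - 2 * t) * D by apply: ler_wpM2l => //; lra.
by lra.
Qed.

Lemma W2sq_projection_le nu mu mu' rho rho' :
  P2 mu -> P2 mu' -> backward_projection nu mu rho ->
  backward_projection nu mu' rho' -> (W2sq rho rho' <= W2sq mu mu')%E.
Proof.
move=> mu2 mu2' hrho hrho'.
have [[rho2 _] _] := hrho; have [[rho2' _] _] := hrho'.
apply/ereal_infP => _ [p cp <-].
have i1 := sqint_law (coupling_fst cp) mu2; have i2 := sqint_law (coupling_snd cp) mu2'.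
rewrite (msqdistE i1 i2) -(fineK (W2sq_fin_num rho2 rho2')) lee_fin.
have near t := @W2sq_projection_near nu mu mu' rho rho' p t mu2 mu2' hrho hrho' cp.
set w := msqdist _ _ _ in near *; set W := fine _ in near *.
pose K := 1 + 2 * `|W| + 2 * `|w| + 6 * d%:R + 2.
have K0 : 0 < K.
  by have := normr_ge0 W; have := normr_ge0 w; have := ler0n R d; rewrite /K; lra.
apply/ler_addgt0Pr => e e0; pose t := Num.min 2^-1 (e / K).
have t0 : 0 < t by rewrite lt_min invr_gt0 ltr0n divr_gt0.
have th : t <= 2^-1 by rewrite ge_min lexx.
have tK : t * K <= e by rewrite -ler_pdivlMr// ge_min lexx orbT.
have := near t t0 th; have := ler_norm W; have := ler_norm w.
by rewrite /K in tK; nra.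
Qed.

End nonexpansive.

Theorem lemma2 (R : realType) (d : nat)
    (nu mu mu' rho rho' : probability (borel_rV R d) R)
    (hnu : @P2 R d nu) (hmu : @P2 R d mu) (hmu' : @P2 R d mu')
    (hrho : backward_projection nu mu rho)
    (hrho' : backward_projection nu mu' rho') :
  (W2 rho rho' <= W2 mu mu')%E.
Proof.
by rewrite lee_sqrt ?W2sq_ge0//; exact: W2sq_projection_le hmu hmu' hrho hrho'.
Qed.
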